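(* Let $\overleftarrow{\mathcal{X}} = (X_i, f_i, f_{ij})$, $i \leqslant j$ in $J$, be a projective system of measurable topological vector spaces and let $(X, (\mathcal{V}_x)_{x\in X}, \mathcal{F}, \tau)$ be its projective limit. Let $(\mu_n)_{n\geqslant 1}$ be a sequence of probability measures on $\mathcal{F}$ and $(v_n)_{n\geqslant 1}$ a sequence of strictly positive reals. For $i \in J$, let $\underline{s}_i, \overline{s}_i, s_i=\underline{s}_i$ and $p_i^*$ denote the functions on $X_i$ associated with $(\mu_n\circ f_i^{-1}, v_n)_{n\geqslant 1}$, and let $\underline{s}, \overline{s}, s=\underline{s}$ and $p^*$ denote the functions on $X$ associated with $(\mu_n, v_n)_{n\geqslant 1}$. (a) If $\underline{s}_i = \overline{s}_i$ for every $i\in J$, then $\underline{s} = \overline{s}$ and $(\mu_n, v_n)_{n\geqslant 1}$ satisfies a weak large deviations principle. (b) If, for every $i \in J$, the compact subsets of $X_i$ are measurable (belong to $\mathcal{F}_i$) and $(\mu_n\circ f_i^{-1}, v_n)_{n\geqslant 1}$ satisfies a weak large deviations principle, then $(\mu_n, v_n)_{n\geqslant 1}$ satisfies a weak large deviations principle. (c) If $s_i = -p_i^*$ for every $i \in J$, then $s = -p^*$.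
   Context: All topologies are assumed Hausdorff (including that of the projective limit); vector spaces are real; $\log 0=-\infty$, $\sup\emptyset=-\infty$. Entropy and weak LDP. Let $Z$ be a set with a $\sigma$-algebra $\mathcal{G}$ and a topology, $(\nu_n)_{n\geqslant1}$ probability measures on $\mathcal{G}$, $(v_n)_{n\geqslant1}$ strictly positive reals. For $x\in Z$, $\underline{s}(x) = \inf \liminf_{n\to\infty} \frac{1}{v_n}\log\nu_n(A)$ and $\overline{s}(x) = \inf \limsup_{n\to\infty} \frac{1}{v_n}\log\nu_n(A)$, both infima over $A\in\mathcal{G}$ whose topological interior contains $x$. The entropy is $s=\underline{s}$. The sequence $(\nu_n,v_n)_{n\geqslant1}$ satisfies a weak large deviations principle if for every relatively compact $K\in\mathcal{G}$ one has $\limsup_{n\to\infty}\frac1{v_n}\log\nu_n(K)\leqslant\sup_{\overline K}s$, where $\overline K$ is the closure of $K$ (the lower bound $\liminf_{n\to\infty}\frac1{v_n}\log\nu_n(A)\geqslant\sup_{\mathrm{int}A}s$ for all $A\in\mathcal{G}$ is automatic). Pressure. If moreover $Z$ is a vector space, let $Z^{*m}$ be the set of continuous and measurable linear forms on $Z$. For $\lambda\in Z^{*m}$ the pressure is $p(\lambda)=\limsup_{n\to\infty}\frac{1}{v_n}\log\int e^{v_n\lambda}\,d\nu_n\in[-\infty,+\infty]$, and for $x\in Z$, $-p^*(x)=\inf_{\lambda\in Z^{*m}}(p(\lambda)-\lambda(x))$. Measurable topological vector space: $(Z,(\mathcal{V}_x)_{x\in Z},\mathcal{G},\sigma)$ where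 $Z$ is a vector space, $\mathcal{G}$ a $\sigma$-algebra and $\sigma$ a topology on $Z$, such that $(Z,\sigma)$ is a topological vector space, each $\mathcal{V}_x$ is a fundamental system of neighbourhoods of $x$ consisting of measurable sets, and every continuous linear form on $Z$ is measurable. Projective system and limit. Let $X$ be a vector space with a $\sigma$-algebra $\mathcal{F}$. A projective system of measurable topological vector spaces is a family $(X_i,f_i,f_{ij})_{i\leqslant j}$ indexed by a preordered upward directed set $(J,\leqslant)$ such that: for each $i\in J$, $(X_i,(\mathcal{V}_{x,i})_{x\in X_i},\mathcal{F}_i,\tau_i)$ is a measurable topological vector space and $f_i:X\to X_i$ is linear and measurable; for $i\leqslant j$, $f_{ij}:X_j\to X_i$ is linear and measurable and, for all $x\in X_j$ and $V\in\mathcal{V}_{f_{ij}(x),i}$, one has $f_{ij}^{-1}(V)\in\mathcal{V}_{x,j}$ (in particular $f_{ij}$ is continuous); and for $i\leqslant j\leqslant k$, $f_{ii}=\mathrm{id}_{X_i}$, $f_i=f_{ij}\circ f_j$, $f_{ik}=f_{ij}\circ f_{jk}$. Its projective limit is $X$ equipped with $\mathcal{F}$, with the initial topology $\tau$ for the family $(f_i)_{i\in J}$, and with $\mathcal{V}_x=\{f_i^{-1}(V_i): i\in J,\ V_i\in\mathcal{V}_{f_i(x),i}\}$ for $x\in X$. (It need not be the full set-theoretic projective limit.)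
   Formalization: In (a), the weak large deviations principle is asserted only when v_n → +∞; without this it fails, e.g. for X = R, J a point, μ_n uniform on [0,1], v_n = 1, where both entropies are -∞ but K = [0,1] has rate 0. *)

(* Defs.v *)
From HB Require Import structures.
From mathcomp Require Import all_boot all_order all_algebra.
From mathcomp Require Import all_classical all_reals all_analysis.

Set Implicit Arguments.
Unset Strict Implicit.
Unset Printing Implicit Defensive.

Import Order.TTheory GRing.Theory Num.Theory.
Import numFieldNormedType.Exports.

Local Open Scope classical_set_scope.
Local Open Scope ring_scope.

(* The hierarchy of MathComp-Analysis has no join of [measurableType] with the
   topological vector spaces, so sigma-algebras are explicit objects. For a
   sigma-algebra [G] on a module [Z], [mspace G] is the type [Z] seen as the
   measurable space (Z, G); it is what measures, integrals and measurable
   functions refer to. *)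
Record sigmaAlgebra (T : Type) := SigmaAlgebra {
  sa_sets :> set T -> Prop ;
  sa_sigma_algebra : sigma_algebra [set: T] sa_sets
}.

Definition mspace (Z : nmodType) (G : sigmaAlgebra Z) : Type := Z.

Section mspace.
Context (Z : nmodType) (G : sigmaAlgebra Z).

Let mspace0 : G set0.
Proof. by case: (sa_sigma_algebra G). Qed.

Let mspaceC (A : set Z) : G A -> G (~` A).
Proof. by rewrite -setTD; case: (sa_sigma_algebra G) => _ + _; apply. Qed.

Let mspaceU (F : (set Z)^nat) : (forall k, G (F k)) -> G (\bigcup_k F k).
Proof. by case: (sa_sigma_algebra G) => _ _; apply. Qed.

HB.instance Definition _ := Choice.on (mspace G).
HB.instance Definition _ := isPointed.Build (mspace G) (0 : Z).
HB.instance Definition _ := @isMeasurable.Build default_measure_display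
  (mspace G) (sa_sets G) mspace0 mspaceC mspaceU.

End mspace.

(* The image measure [mu \o f^-1]. *)
Definition image_measure (R : realType) (Y Z : nmodType) (G : sigmaAlgebra Y)
    (H : sigmaAlgebra Z) (mu : probability (mspace G) R) (f : Y -> Z) :
    set Z -> \bar R :=
  pushforward mu (f : mspace G -> mspace H).

(* Below, a sequence of measures is a sequence [nu] of set functions. Sequences
   indexed by n >= 1 are indexed by [nat]: term n stands for term n+1 of the
   original sequence. The extended logarithm [lne] satisfies lne 0 = -oo and
   lne +oo = +oo. *)
Section entropy.
Context (R : realType) (Z : topologicalType) (G : sigmaAlgebra Z).
Variables (v : nat -> R) (nu : nat -> set Z -> \bar R).

Definition log_rate (A : set Z) (n : nat) : \bar R :=
  (((v n)^-1)%:E * lne (nu n A))%E.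

Definition lower_entropy (x : Z) : \bar R :=
  ereal_inf [set limn_einf (log_rate A) | A in
    [set A : set Z | G A /\ interior A x]].

Definition upper_entropy (x : Z) : \bar R :=
  ereal_inf [set limn_esup (log_rate A) | A in
    [set A : set Z | G A /\ interior A x]].

Definition entropy : Z -> \bar R := lower_entropy.

(* [ereal_sup set0 = -oo] *)
Definition weak_LDP : Prop :=
  forall K : set Z, G K -> compact (closure K) ->
    (limn_esup (log_rate K) <= ereal_sup [set entropy x | x in closure K])%E.

End entropy.

Section pressure.
Context (R : realType) (Z : preTopologicalLmodType R) (G : sigmaAlgebra Z).
Variables (v : nat -> R) (nu : nat -> set Z -> \bar R).

Definition measurable_form (l : {scalar Z}) : Prop :=
  measurable_fun setT (l : mspace G -> R).

Definition cont_meas_dual : set {scalar Z} :=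
  [set l : {scalar Z} | continuous (l : Z -> R) /\ measurable_form l].

Definition pressure (l : {scalar Z}) : \bar R :=
  limn_esup (fun n => ((v n)^-1)%:E *
    lne (\int[(nu n : set (mspace G) -> \bar R)]_z (expR (v n * l z))%:E))%E.

(* The conjugate p^*, defined through its opposite
   -p^*(x) = inf_l (p(l) - l(x)). *)
Definition pressure_conj (x : Z) : \bar R :=
  (- ereal_inf [set (pressure l - (l x)%:E)%E | l in cont_meas_dual])%E.

End pressure.

(* [topologicalLmodType] is a topological vector space, not assumed to be
   locally convex nor Hausdorff. *)
Record is_measurable_tvs (R : realType) (Z : topologicalLmodType R)
    (G : sigmaAlgebra Z) (V : Z -> set (set Z)) : Prop := {
  mtvs_hausdorff : hausdorff_space Z ;
  mtvs_nbhs : forall x A, V x A -> nbhs x A ;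
  mtvs_fundamental : forall x N, nbhs x N -> exists2 A, V x A & A `<=` N ;
  mtvs_measurable : forall x A, V x A -> G A ;
  mtvs_form : forall l : {scalar Z}, continuous (l : Z -> R) ->
    measurable_form G l
}.

(* Here [X] only needs to be a module with a sigma-algebra. [J] is not required
   to be nonempty. *)
Record is_projective_system (dJ : Order.disp_t) (J : preorderType dJ)
    (R : realType) (X : lmodType R) (G : sigmaAlgebra X)
    (Xi : J -> topologicalLmodType R) (Gi : forall i, sigmaAlgebra (Xi i))
    (Vi : forall i, Xi i -> set (set (Xi i)))
    (f : forall i, {linear X -> Xi i})
    (fij : forall i j, (i <= j)%O -> {linear Xi j -> Xi i}) : Prop := {
  ps_directed : forall i j : J, exists k, (i <= k)%O /\ (j <= k)%O ;
  ps_mtvs : forall i, is_measurable_tvs (Gi i) (@Vi i) ;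
  ps_measurable : forall i,
    measurable_fun setT (f i : mspace G -> mspace (Gi i)) ;
  ps_measurable_trans : forall i j (ij : (i <= j)%O),
    measurable_fun setT (fij i j ij : mspace (Gi j) -> mspace (Gi i)) ;
  ps_preimage : forall i j (ij : (i <= j)%O) (x : Xi j) (A : set (Xi i)),
    Vi i (fij i j ij x) A -> Vi j x (fij i j ij @^-1` A) ;
  ps_id : forall i (ii : (i <= i)%O) x, fij i i ii x = x ;
  ps_factor : forall i j (ij : (i <= j)%O) x, f i x = fij i j ij (f j x) ;
  ps_comp : forall i j k (ij : (i <= j)%O) (jk : (j <= k)%O) (ik : (i <= k)%O)
    x, fij i k ik x = fij i j ij (fij j k jk x)
}.

Definition initial_family_topology (J : Type) (X : choiceType)
    (Xi : J -> topologicalType) (f : forall i, X -> Xi i) : topologicalType :=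
  sup_topology (fun i => Topological.on (initial_topology (f i))).

(* The topology of the limit is the one carried by [X] as a topological type;
   [pl_topology] identifies it with the initial topology. *)
Record is_projective_limit (J : Type) (R : realType)
    (X : preTopologicalLmodType R) (Xi : J -> topologicalLmodType R)
    (Vi : forall i, Xi i -> set (set (Xi i)))
    (f : forall i, {linear X -> Xi i}) (V : X -> set (set X)) : Prop := {
  pl_topology : forall A : set X,
    open A <-> open (A : set (initial_family_topology f)) ;
  pl_nbhs : forall x, V x =
    [set A | exists i, exists2 B, Vi i (f i x) B & A = f i @^-1` B] ;
  pl_hausdorff : hausdorff_space X
}.

(* Main.v *)
Require Import Defs.
From HB Require Import structures.
From mathcomp Require Import all_boot all_order all_algebra.
From mathcomp Require Import all_classical all_reals all_analysis.
From mathcomp Require Import measurable_realfun lra.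

Set Implicit Arguments.
Unset Strict Implicit.
Unset Printing Implicit Defensive.

Import Order.TTheory GRing.Theory Num.Theory.
Import numFieldNormedType.Exports.

Local Open Scope classical_set_scope.
Local Open Scope ring_scope.

(** The limit carries the initial topology of a directed system, so every
    neighbourhood of [x] contains a cylinder [f i @^-1` B] with [B] a measurable
    neighbourhood of [f i x], and [mu n] gives this cylinder the mass that the
    image measure gives to [B]. Hence both entropies of the limit are infima over
    [i] of the entropies of the images ([lower_entropy_limit],
    [upper_entropy_limit]). When [J] is empty the only neighbourhood is the whole
    space, whose log-rate is 0; the infimum is therefore taken together with
    the value 0, which is harmless because entropies are nonpositive.

    (a) Equality of the two entropies passes to the infimum
    ([lower_eq_upper_limit]). Once they agree, a compact set is covered by
    finitely many sets of small upper rate, and a finite union costs nothing at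
    the scale [v n] as [v n] tends to infinity ([weak_LDP_entropy_eq]).

    (b) Bounding a compact set by the preimages of its images yields the infimum
    over [i] of the suprema over [x] of [s_i (f i x)], where the supremum of the
    infima is wanted. The functions [s_i \o f i] are upper semicontinuous and
    decrease along the directed set, so the two agree on compact sets by a
    Dini argument ([weak_LDP_limit]).

    (c) The bound [s <= - p^*] holds on any space, by Chebyshev's inequality on
    half-spaces ([entropy_le_conj]). Conversely a form on [Xi i] composed with
    [f i] is a form on [X] with the same pressure, so [- p^*] is at most the
    infimum of the [- p_i^* \o f i], which is [s] ([conj_le_entropy]).

    Both compactness arguments apply the same principle: a family of sets that
    contains the empty set and some neighbourhood of each point of a compact set,
    and is closed under subsets and finite unions, contains that compact set
    ([compact_ideal_ind]). *)

(** * Limits inferior and superior *)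

Lemma lee_lt_EFin (R : realType) (x y : \bar R) :
  (forall r : R, (y < r%:E)%E -> (x <= r%:E)%E) -> (x <= y)%E.
Proof.
case: y => [y||] h; last 2 first.
- exact: leey.
- case: x h => [x||] h //.
  + by have := h (x - 1) ltac:(exact: ltNyr); rewrite lee_fin lerBrDr gerDl ler10.
  + by have := h 0 ltac:(exact: ltNyr).
- apply/lee_addgt0Pr => e e0; rewrite -EFinD; apply: h.
  by rewrite lte_fin ltrDl.
Qed.

Lemma limn_esup_ltP (R : realType) (u : nat -> \bar R) (c : \bar R) :
  (limn_esup u < c)%E -> \forall n \near \oo, (u n < c)%E.
Proof.
move=> /ereal_inf_lt[_ [A FA <-] supc]; apply: filterS FA => n An.
by apply: le_lt_trans supc; apply: ereal_sup_ubound; exists n.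
Qed.

Lemma limn_esup_le (R : realType) (u : nat -> \bar R) (c : \bar R) :
  (\forall n \near \oo, (u n <= c)%E) -> (limn_esup u <= c)%E.
Proof.
move=> uc; apply: ge_ereal_inf.
exists (ereal_sup (u @` [set n | (u n <= c)%E])).
  by exists [set n | (u n <= c)%E].
by apply: ge_ereal_sup => _ [n unc <-].
Qed.

Lemma le_limn_esup (R : realType) (u w : nat -> \bar R) :
  (forall n, (u n <= w n)%E) -> (limn_esup u <= limn_esup w)%E.
Proof.
move=> uw; apply: lee_lt_EFin => r /limn_esup_ltP wr.
apply: limn_esup_le; apply: filterS wr => n wnr.
by apply: le_trans (uw n) _; exact: ltW.
Qed.

Lemma le_limn_einf (R : realType) (u w : nat -> \bar R) :
  (forall n, (u n <= w n)%E) -> (limn_einf u <= limn_einf w)%E.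
Proof.
by move=> uw; rewrite leeN2; apply: le_limn_esup => n; rewrite leeN2.
Qed.

(** * Compactness and infima over measurable neighbourhoods *)

(** If [P K] failed, the sets [B] such that [P (K `\` B)] would form a proper
    filter containing [K]; at a cluster point in [K] the local hypothesis gives a
    neighbourhood whose complement is in the filter. *)
Lemma compact_ideal_ind (T : topologicalType) (K : set T) (P : set T -> Prop) :
  compact K -> P set0 ->
  (forall A B, A `<=` B -> P B -> P A) ->
  (forall A B, P A -> P B -> P (A `|` B)) ->
  (forall x, K x -> exists2 A, nbhs x A & P A) -> P K.
Proof.
move=> cK P0 Ps PU locP; apply: contrapT => nPK.
pose F : set_system T := [set B | P (K `\` B)].
have FF : ProperFilter F.
  split; first by rewrite /F /= setD0.
  split; rewrite /F /= ?setDT// => A B; last first.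
    by move=> AB; apply: Ps => x [Kx nBx]; split => // /AB.
  by rewrite [X in _ -> _ -> P X]setDIr; exact: PU.
have [|x [Kx clx]] := cK F FF; first by rewrite /F /= setDv.
have [A xA PA] := locP x Kx.
have [|y [ny Ay]] // := clx (~` A) A _ xA.
by rewrite /F /= setDE setCK; apply: Ps PA; exact: subIsetr.
Qed.

(** The two entropies are the cases where [phi] is the lower or the upper limit
    of the log-rates, which lets both be treated at once. *)
Definition germ_inf (R : realType) (Z : topologicalType) (G : sigmaAlgebra Z)
    (phi : set Z -> \bar R) (x : Z) : \bar R :=
  ereal_inf [set phi A | A in [set A : set Z | G A /\ interior A x]].

Lemma germ_inf_ltP (R : realType) (Z : topologicalType) (G : sigmaAlgebra Z)
    (phi : set Z -> \bar R) (x : Z) (c : \bar R) :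
  (germ_inf G phi x < c)%E <->
  exists A, [/\ G A, nbhs x A & (phi A < c)%E].
Proof.
split=> [/ereal_inf_lt[_ [A [GA Ax] <-] Ac]|[A [GA Ax Ac]]].
  by exists A.
by apply: le_lt_trans Ac; apply: ereal_inf_lbound; exists A.
Qed.

Lemma sa_setT (T : Type) (G : sigmaAlgebra T) : G setT.
Proof.
by case: (sa_sigma_algebra G) => G0 GC _; rewrite -(setD0 setT); exact: GC.
Qed.

Lemma sa_preimage (Y Z : nmodType) (G : sigmaAlgebra Y) (H : sigmaAlgebra Z)
    (f : Y -> Z) :
  measurable_fun setT (f : mspace G -> mspace H) ->
  forall B, H B -> G (f @^-1` B).
Proof. by move=> mf B HB; rewrite -[X in G X]setTI; exact: mf. Qed.

(** * Logarithmic rates *)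

Lemma log_rate_mono (R : realType) (X : preTopologicalLmodType R)
    (G : sigmaAlgebra X) (mu : nat -> probability (mspace G) R) (v : nat -> R) :
  (forall n, 0 < v n) -> forall A B n, G A -> G B -> A `<=` B ->
  (log_rate v mu A n <= log_rate v mu B n)%E.
Proof.
move=> v0 A B n GA GB AB; apply: lee_wpmul2l; first by rewrite lee_fin invr_ge0 ltW.
rewrite lee_lne ?in_itv/= ?leey ?andbT ?measure_ge0//.
by apply: le_measure => //; rewrite inE.
Qed.

Lemma log_rate_setT (R : realType) (X : preTopologicalLmodType R)
    (G : sigmaAlgebra X) (mu : nat -> probability (mspace G) R) (v : nat -> R) n :
  log_rate v mu setT n = 0%E.
Proof.
by rewrite /log_rate (_ : mu n setT = 1%E) ?lne1 ?mule0//; exact: probability_setT.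
Qed.

Lemma cvg_log_rate_setT (R : realType) (X : preTopologicalLmodType R)
    (G : sigmaAlgebra X) (mu : nat -> probability (mspace G) R) (v : nat -> R) :
  log_rate v mu setT @ \oo --> 0%E.
Proof.
rewrite (_ : log_rate v mu setT = cst 0%E); first exact: cvg_cst.
by apply/funext => n; rewrite log_rate_setT.
Qed.

Lemma log_rate_set0 (R : realType) (X : preTopologicalLmodType R)
    (G : sigmaAlgebra X) (mu : nat -> probability (mspace G) R) (v : nat -> R) n :
  0 < v n -> log_rate v mu set0 n = -oo%E.
Proof.
move=> v0; rewrite /log_rate measure0 le0_lneNy//.
by rewrite gt0_muleNy ?lte_fin ?invr_gt0.
Qed.

Lemma scaled_lne_le (R : realType) (v r : R) (m : \bar R) :
  0 < v -> (0 <= m)%E ->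
  ((v^-1)%:E * lne m <= r%:E)%E = (m <= (expR (v * r))%:E)%E.
Proof.
move=> v0 m0; rewrite lee_pdivrMl// -EFinM -[LHS]lee_expeR lneK//.
by rewrite in_itv/= m0 leey.
Qed.

Lemma scaled_lne_shift (R : realType) (v r : R) (m : \bar R) :
  0 < v -> (0 <= m)%E ->
  ((v^-1)%:E * lne ((expR (v * r))%:E * m) = r%:E + (v^-1)%:E * lne m)%E.
Proof.
move=> v0; rewrite le_eqVlt => /predU1P[<-|m0].
  by rewrite mule0 le0_lneNy// gt0_muleNy ?lte_fin ?invr_gt0// addeNy.
have e0 : (0 < (expR (v * r))%:E)%E by rewrite lte_fin expR_gt0.
rewrite lneM; try by rewrite in_itv/= leey ?m0 ?e0.
rewrite lne_EFin ?expR_gt0// expRK muleDr//.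
by rewrite -EFinM mulKf ?gt_eqF.
Qed.

(** If both sets have mass at most [expR (v n * (c + e / 2))], their union has at
    most twice this, and [2 <= expR (v n * (e / 2))] as soon as
    [ln 2 / (e / 2) <= v n]. *)
Lemma limsup_log_rate_setU (R : realType) (X : preTopologicalLmodType R)
    (G : sigmaAlgebra X) (mu : nat -> probability (mspace G) R) (v : nat -> R)
    (c : R) A B :
  (forall n, 0 < v n) -> v n @[n --> \oo] --> +oo -> G A -> G B ->
  (limn_esup (log_rate v mu A) <= c%:E)%E ->
  (limn_esup (log_rate v mu B) <= c%:E)%E ->
  (limn_esup (log_rate v mu (A `|` B)) <= c%:E)%E.
Proof.
move=> v0 voo GA GB Ac Bc; apply/lee_addgt0Pr => e e0.
have e20 : 0 < e / 2 by rewrite divr_gt0.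
have {}Ac : (limn_esup (log_rate v mu A) < (c + e / 2)%:E)%E.
  by apply: le_lt_trans Ac _; rewrite lte_fin ltrDl.
have {}Bc : (limn_esup (log_rate v mu B) < (c + e / 2)%:E)%E.
  by apply: le_lt_trans Bc _; rewrite lte_fin ltrDl.
rewrite -EFinD; apply: limn_esup_le.
near=> n.
have /ltW : (log_rate v mu A n < (c + e / 2)%:E)%E.
  by near: n; exact: limn_esup_ltP.
have /ltW : (log_rate v mu B n < (c + e / 2)%:E)%E.
  by near: n; exact: limn_esup_ltP.
rewrite /log_rate !scaled_lne_le ?measure_ge0// => Bn An.
apply: le_trans (measureU2 (mu n) GA GB) _; apply: le_trans (leeD An Bn) _.
have vn : ln 2 / (e / 2) <= v n.
  by near: n; move/cvgryPge : voo; apply.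
rewrite -EFinD lee_fin -mulr2n -[leLHS]mulr_natl.
have -> y : 2%:R * expR y = expR (ln 2 + y) by rewrite expRD lnK// posrE.
rewrite ler_expR; rewrite ler_pdivrMr// in vn.
by rewrite mulrDr [leRHS](_ : _ = v n * (e / 2) + (v n * c + v n * (e / 2))) ?lerD2r//; lra.
Unshelve. all: by end_near. Qed.

(** The hypothesis converts the bound on the lower entropy, which is what the
    conclusion controls, into a bound on upper limits, which can be added up
    over a finite cover. *)
Lemma weak_LDP_entropy_eq (R : realType) (X : preTopologicalLmodType R)
    (G : sigmaAlgebra X) (mu : nat -> probability (mspace G) R) (v : nat -> R) :
  (forall n, 0 < v n) -> v n @[n --> \oo] --> +oo ->
  (forall x, lower_entropy G v mu x = upper_entropy G v mu x) ->
  weak_LDP G v mu.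
Proof.
move=> v0 voo lu K GK cK; apply: lee_lt_EFin => c supc.
pose P B := exists A, [/\ G A, B `<=` A &
  (limn_esup (log_rate v mu A) <= c%:E)%E].
suff [A [GA KA Ac]] : P (closure K).
  apply: le_trans Ac; apply: le_limn_esup => n; apply: log_rate_mono => //.
  exact: subset_trans (@subset_closure _ _) KA.
apply: compact_ideal_ind => //.
- exists set0; split => //; first by case: (sa_sigma_algebra G).
  apply: limn_esup_le; apply: nearW => n.
  by rewrite log_rate_set0 ?leNye.
- by move=> A B AB [C [GC BC Cc]]; exists C; split => //; exact: subset_trans BC.
- move=> A B [A' [GA AA' A'c]] [B' [GB BB' B'c]]; exists (A' `|` B'); split.
  + exact: (@measurableU _ (mspace G)).
  + exact: setUSS.
  + exact: limsup_log_rate_setU.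
- move=> x Kx.
  have : (upper_entropy G v mu x < c%:E)%E.
    rewrite -lu; apply: le_lt_trans supc.
    by apply: ereal_sup_ubound; exists x.
  move=> /germ_inf_ltP[A [GA xA Ac]]; exists A => //.
  by exists A; split => //; exact: ltW.
Qed.

(** On the half-space [l z > l x - e], a neighbourhood of [x], the integrand is at
    least [expR (v n * (l x - e))]. *)
Lemma entropy_le_conj (R : realType) (X : preTopologicalLmodType R)
    (G : sigmaAlgebra X) (mu : nat -> probability (mspace G) R) (v : nat -> R) x :
  (forall n, 0 < v n) ->
  (entropy G v mu x <= - pressure_conj G v mu x)%E.
Proof.
move=> v0; rewrite oppeK; apply: le_ereal_inf_tmp => _ [l [cl ml] <-].
rewrite leeBrDr//; apply/lee_addgt0Pr => e e0.
rewrite -leeBlDr// -addeA -EFinB.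
pose A := [set z | l x - e < l z].
have GA : G A.
  have -> : A = setT `&` (l : mspace G -> R) @^-1` `]l x - e, +oo[%classic.
    by apply/seteqP; split => z; rewrite /A /= in_itv/= andbT => // -[].
  exact: ml.
have xA : nbhs x A.
  by apply: (cvgr_gt (l x) (cl x)); rewrite ltrBlDr ltrDl.
apply: (@le_trans _ _ ((l x - e)%:E + limn_einf (log_rate v mu A))%E).
  by rewrite addeC leeD2l//; apply: ereal_inf_lbound; exists A.
rewrite -limn_einf_shift//; apply: le_trans (limn_einf_sup _) _.
apply: le_limn_esup => n.
rewrite /log_rate -scaled_lne_shift//.
have mexp : measurable_fun setT ((fun z => (expR (v n * l z))%:E) : mspace G -> \bar R).
  apply/measurable_EFinP; apply: measurableT_comp => //.
  exact: measurable_funM.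
apply: lee_wpmul2l; first by rewrite lee_fin invr_ge0 ltW.
rewrite lee_lne; last 2 first.
- by rewrite in_itv/= leey mule_ge0// lee_fin expR_ge0.
- by rewrite in_itv/= leey integral_ge0// => z _; rewrite lee_fin expR_ge0.
apply: (@le_trans _ _ (\int[mu n]_(z in (A : set (mspace G))) (expR (v n * l z))%:E)%E).
  rewrite -(integral_cst (mu n) (GA : measurable (A : set (mspace G)))).
  apply: ge0_le_integral => //.
  - by move=> z _; rewrite lee_fin expR_ge0.
  - exact: measurable_funTS.
  - by move=> z Az; rewrite lee_fin ler_expR ler_pM2l// ltW.
exact: ge0_subset_integral.
Qed.

Lemma pressure0 (R : realType) (X : preTopologicalLmodType R)
    (G : sigmaAlgebra X) (mu : nat -> probability (mspace G) R) (v : nat -> R) :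
  pressure G v mu \0 = 0%E.
Proof.
rewrite /pressure -[RHS](cvg_limn_einf_sup (cvg_cst 0%E)).2.
congr limn_esup; apply/funext => n.
under eq_integral do rewrite /= mulr0 expR0.
by rewrite integral_cst// mul1e [X in lne X](_ : _ = 1%E) ?lne1 ?mule0//; exact: probability_setT.
Qed.

(** * Projective limits *)

Section limit.
Context (R : realType) (dJ : Order.disp_t) (J : preorderType dJ)
  (X : preTopologicalLmodType R) (G : sigmaAlgebra X)
  (Xi : J -> topologicalLmodType R) (Gi : forall i, sigmaAlgebra (Xi i))
  (Vi : forall i, Xi i -> set (set (Xi i)))
  (f : forall i, {linear X -> Xi i})
  (fij : forall i j, (i <= j)%O -> {linear Xi j -> Xi i})
  (V : X -> set (set X)).
Hypotheses (Hsys : is_projective_system G Gi Vi f fij)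
  (Hlim : is_projective_limit Vi f V).

Lemma transition_continuous i j (ij : (i <= j)%O) : continuous (fij ij).
Proof.
move=> y N /(mtvs_fundamental (ps_mtvs Hsys i))[B VB BN].
apply: filterS (mtvs_nbhs (ps_mtvs Hsys j) (ps_preimage Hsys VB)).
exact: preimage_subset BN.
Qed.

Lemma projection_continuous i : continuous (f i).
Proof.
apply/continuousP => B oB; apply/(pl_topology Hlim).
rewrite openE => x Bx.
have /cvg_sup/(_ i) : nbhs (x : initial_family_topology f) --> x by [].
by apply; exists (f i @^-1` B); split => //; exists B.
Qed.

Lemma projection_preimage i B : Gi i B -> G (f i @^-1` B).
Proof. exact: (sa_preimage (ps_measurable Hsys (i:=i))). Qed.

(** Since [J] is directed, the supersets of cylinders around [x] form a filter,
    and it converges to [x] for each [initial_topology (f i)], hence for their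
    supremum. The alternative [N = setT] is needed when [J] is empty. *)
Lemma limit_nbhs x N : nbhs x N ->
  N = setT \/ exists i B, nbhs (f i x) B /\ f i @^-1` B `<=` N.
Proof.
pose F : set_system X := [set N | N = setT \/
  exists i B, nbhs (f i x) B /\ f i @^-1` B `<=` N].
have FF : Filter F.
  split; first by left.
    move=> A B [->|[i [A' [iA AA']]]]; first by rewrite setTI.
    move=> [->|[j [B' [jB BB']]]]; first by rewrite setIT; right; exists i, A'.
    have [k [ik jk]] := ps_directed Hsys i j.
    right; exists k, (fij ik @^-1` A' `&` fij jk @^-1` B'); split.
      apply: filterI; apply: transition_continuous.
        by rewrite -(ps_factor Hsys).
      by rewrite -(ps_factor Hsys).
    move=> y /= []; rewrite -!(ps_factor Hsys) => iy jy.
    by split; [exact: AA'|exact: BB'].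
  move=> A B AB [A1|[i [C [iC CA]]]].
    by left; apply/seteqP; split => // y _; apply: AB; rewrite A1.
  by right; exists i, C; split => //; apply: subset_trans AB.
have FX : F --> (x : initial_family_topology f).
  apply/cvg_sup => i A [_ [[B oB <-] Bx BA]].
  by right; exists i, B; split => //; exact: open_nbhs_nbhs.
rewrite nbhsE => -[U [+ Ux] UN]; move=> /(pl_topology Hlim) oU.
apply: (@filterS _ F _ _ _ UN); apply: FX; exact: open_nbhs_nbhs.
Qed.

(** Every neighbourhood contains a cylinder over a basic neighbourhood, which is
    measurable, so by monotonicity of [phi] cylinders suffice to compute the
    infimum. Stating this with strict bounds by [c] keeps the case of an empty
    [J] to one disjunct. *)
Lemma germ_inf_limit (phi : set X -> \bar R) x c :
  (forall A B, G A -> G B -> A `<=` B -> phi A <= phi B)%E ->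
  (germ_inf G phi x < c)%E <->
  (phi setT < c)%E \/
  exists i, (germ_inf (Gi i) (fun B => phi (f i @^-1` B)) (f i x) < c)%E.
Proof.
move=> phi_mono; split.
- move=> /germ_inf_ltP[A [GA Ax Ac]].
  have [AT|[i [N [xN NA]]]] := limit_nbhs Ax.
    by left; rewrite -AT.
  right; exists i; have [B VB BN] := mtvs_fundamental (ps_mtvs Hsys i) xN.
  have GB := mtvs_measurable (ps_mtvs Hsys i) VB.
  apply/germ_inf_ltP; exists B; split => //.
    exact: (mtvs_nbhs (ps_mtvs Hsys i) VB).
  apply: le_lt_trans Ac; apply: phi_mono => //.
    exact: projection_preimage.
  exact: subset_trans (preimage_subset BN) NA.
- move=> [Tc|[i /germ_inf_ltP[B [GB Bx Bc]]]]; apply/germ_inf_ltP.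
    by exists setT; split => //; [exact: sa_setT|exact: filterT].
  exists (f i @^-1` B); split => //.
    exact: projection_preimage.
  exact: projection_continuous.
Qed.

(** Along [i <= j], a neighbourhood in [Xi i] is pulled back to one in [Xi j]
    with the same trace on [X]. *)
Lemma germ_inf_transition (phi : set X -> \bar R) i j (ij : (i <= j)%O) x :
  (germ_inf (Gi j) (fun B => phi (f j @^-1` B)) (f j x) <=
   germ_inf (Gi i) (fun B => phi (f i @^-1` B)) (f i x))%E.
Proof.
apply: le_ereal_inf_tmp => _ [B [GB Bx] <-].
apply: ereal_inf_lbound; exists (fij ij @^-1` B).
  split; first exact: (sa_preimage (ps_measurable_trans Hsys ij) GB).
  by apply: transition_continuous; rewrite -(ps_factor Hsys).
by congr phi; apply/seteqP; split => y /=; rewrite -(ps_factor Hsys).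
Qed.

(** * Entropies and pressures of the limit *)

Context (mu : nat -> probability (mspace G) R) (v : nat -> R).
Hypothesis Hv : forall n, 0 < v n.
Local Notation mui i := (fun n => image_measure (Gi i) (mu n) (f i)).

Lemma lower_entropy_limit x c :
  (lower_entropy G v mu x < c)%E <->
  (0 < c)%E \/ exists i, (lower_entropy (Gi i) v (mui i) (f i x) < c)%E.
Proof.
rewrite -[X in (X < c)%E \/ _](cvg_limn_einf_sup (cvg_log_rate_setT mu v)).1.
apply: (germ_inf_limit (phi := fun A => limn_einf (log_rate v mu A))).
by move=> A B GA GB AB; apply: le_limn_einf => n; exact: log_rate_mono.
Qed.

Lemma upper_entropy_limit x c :
  (upper_entropy G v mu x < c)%E <->
  (0 < c)%E \/ exists i, (upper_entropy (Gi i) v (mui i) (f i x) < c)%E.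
Proof.
rewrite -[X in (X < c)%E \/ _](cvg_limn_einf_sup (cvg_log_rate_setT mu v)).2.
apply: (germ_inf_limit (phi := fun A => limn_esup (log_rate v mu A))).
by move=> A B GA GB AB; apply: le_limn_esup => n; exact: log_rate_mono.
Qed.

Lemma lower_eq_upper_limit :
  (forall i y, lower_entropy (Gi i) v (mui i) y =
               upper_entropy (Gi i) v (mui i) y) ->
  forall x, lower_entropy G v mu x = upper_entropy G v mu x.
Proof.
move=> lu x; apply/eqP; rewrite eq_le; apply/andP; split.
  rewrite leNgt; apply/negP => /upper_entropy_limit ul.
  suff /lower_entropy_limit : (0 < lower_entropy G v mu x)%E \/
    exists i, (lower_entropy (Gi i) v (mui i) (f i x) <
               lower_entropy G v mu x)%E by rewrite ltxx.
  by case: ul => [|[i ui]]; [left|right; exists i; rewrite lu].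
rewrite leNgt; apply/negP => /lower_entropy_limit ul.
suff /upper_entropy_limit : (0 < upper_entropy G v mu x)%E \/
  exists i, (upper_entropy (Gi i) v (mui i) (f i x) <
             upper_entropy G v mu x)%E by rewrite ltxx.
by case: ul => [|[i ui]]; [left|right; exists i; rewrite -lu].
Qed.

(** Upper semicontinuity: a set witnessing the bound at [y] witnesses it at every
    point of its interior. *)
Lemma entropy_usc i c y : (entropy (Gi i) v (mui i) y < c)%E ->
  \forall z \near y, (entropy (Gi i) v (mui i) z < c)%E.
Proof.
move=> /germ_inf_ltP[A [GA yA Ac]].
move: (nbhs_interior yA); apply: filterS => z zA.
by apply/germ_inf_ltP; exists A.
Qed.

(** Given [c] above the supremum of [s] on [closure K], the Dini argument yields
    one index [i] with [s_i \o f i < c] on all of [closure K]; the upper bound in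
    [Xi i], applied to the compact and hence measurable set
    [f i @` closure K], then bounds the rate of [K] by [c]. *)
Lemma weak_LDP_limit :
  (forall i (K : set (Xi i)), compact K -> Gi i K) ->
  (forall i, weak_LDP (Gi i) v (mui i)) ->
  weak_LDP G v mu.
Proof.
move=> Hcomp Hldp K GK cK; apply: lee_lt_EFin => c supc.
have [->|/set0P[x0 Kx0]] := eqVneq K set0.
  by apply: limn_esup_le; apply: nearW => n; rewrite log_rate_set0 ?leNye.
have Kc x : closure K x -> (entropy G v mu x < c%:E)%E.
  move=> Kx; apply: le_lt_trans supc.
  by apply: ereal_sup_ubound; exists x.
(* For [0 < c] the bound is trivial, as rates of probabilities are at most 0;
   for [c <= 0] the second alternative of [lower_entropy_limit] holds. *)
have [c0|c0] := ltP 0%E c%:E.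
  apply: le_trans (ltW c0); apply: limn_esup_le; apply: nearW => n.
  rewrite -(log_rate_setT mu v n); apply: log_rate_mono => //.
  exact: sa_setT.
have Kic x : closure K x -> exists i, (entropy (Gi i) v (mui i) (f i x) < c%:E)%E.
  by move=> /Kc /lower_entropy_limit[] //; rewrite ltNge c0.
(* By monotonicity in [i] these sets form an ideal, so a single index serves all
   points of the compact set. *)
pose P B := exists i, forall x, B x -> (entropy (Gi i) v (mui i) (f i x) < c%:E)%E.
have [i Pi] : P (closure K).
  apply: compact_ideal_ind => //.
  - by have [i _] := Kic x0 (subset_closure Kx0); exists i.
  - by move=> A B AB [i Bi]; exists i => x /AB; exact: Bi.
  - move=> A B [i Ai] [j Bj]; have [k [ik jk]] := ps_directed Hsys i j.
    have dec h (hk : (h <= k)%O) x : (entropy (Gi k) v (mui k) (f k x) <=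
        entropy (Gi h) v (mui h) (f h x))%E.
      exact: (germ_inf_transition (fun A => limn_einf (log_rate v mu A)) hk).
    exists k => x [/Ai|/Bj]; apply: le_lt_trans; exact: dec.
  - move=> x /Kic[i xi]; exists (f i @^-1` [set y | (entropy (Gi i) v (mui i) y < c%:E)%E]).
      by apply: projection_continuous; exact: entropy_usc.
    by exists i.
have cfK : compact (f i @` closure K).
  apply: continuous_compact => //; apply: continuous_subspaceT.
  exact: projection_continuous.
have clfK : closed (f i @` closure K).
  exact: compact_closed (mtvs_hausdorff (ps_mtvs Hsys i)) cfK.
have GfK := Hcomp i _ cfK.
apply: (@le_trans _ _ (limn_esup (log_rate v (mui i) (f i @` closure K)))).
  apply: le_limn_esup => n.
  apply: (@log_rate_mono _ _ G mu v Hv _ (f i @^-1` (f i @` closure K))) => //.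
    exact: projection_preimage.
  by move=> x Kx; exists x => //; exact: subset_closure.
have := Hldp i _ GfK; rewrite -((closure_id _).1 clfK) => /(_ cfK).
move=> /le_trans; apply; apply: ge_ereal_sup => _ [_ [x Kx <-] <-].
exact/ltW/Pi.
Qed.

Lemma pressure_image i (l : {scalar (Xi i)}) : measurable_form (Gi i) l ->
  pressure G v mu (l \o f i) = pressure (Gi i) v (mui i) l.
Proof.
move=> ml; rewrite /pressure; congr limn_esup; apply/funext => n.
congr (_ * lne _)%E; apply/esym.
rewrite /image_measure.
apply: (ge0_integral_pushforward (ps_measurable Hsys (i:=i))) => //.
apply/measurable_EFinP; apply: measurableT_comp => //.
exact: measurable_funM.
Qed.

(** The zero form gives [- p^* <= 0]; it covers the alternative [0 < c] of
    [lower_entropy_limit], the only one available when [J] is empty. *)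
Lemma conj_le_entropy :
  (forall i y, entropy (Gi i) v (mui i) y =
               (- pressure_conj (Gi i) v (mui i) y)%E) ->
  forall x, (- pressure_conj G v mu x <= entropy G v mu x)%E.
Proof.
move=> H x; rewrite leNgt; apply/negP => /lower_entropy_limit[p0|[i]].
  have : (- pressure_conj G v mu x <= 0)%E.
    rewrite oppeK -(pressure0 mu v).
    rewrite -[leRHS]sube0; apply: ereal_inf_lbound; exists \0 => //.
    by split; [exact: cst_continuous|exact: measurable_cst].
  by rewrite leNgt p0.
rewrite [X in (X < _)%E]H oppeK => /ereal_inf_lt[_ [l [cl ml] <-]].
apply/negP; rewrite -leNgt oppeK; apply: ereal_inf_lbound.
exists (l \o f i); last by rewrite pressure_image.
split.
  move=> y; apply: continuous_comp; first exact: projection_continuous.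
  exact: cl.
have mfi := ps_measurable Hsys (i:=i).
exact: (measurableT_comp ml mfi).
Qed.

End limit.

Theorem mainTheorem1 (R : realType) (dJ : Order.disp_t) (J : preorderType dJ)
    (X : preTopologicalLmodType R) (G : sigmaAlgebra X)
    (Xi : J -> topologicalLmodType R) (Gi : forall i, sigmaAlgebra (Xi i))
    (Vi : forall i, Xi i -> set (set (Xi i)))
    (f : forall i, {linear X -> Xi i})
    (fij : forall i j, (i <= j)%O -> {linear Xi j -> Xi i})
    (V : X -> set (set X))
    (mu : nat -> probability (mspace G) R) (v : nat -> R)
    (Hsys : is_projective_system G Gi Vi f fij)
    (Hlim : is_projective_limit Vi f V)
    (Hv : forall n, 0 < v n) :
  let mui := fun i n => image_measure (Gi i) (mu n) (f i) in
  ((forall i y, lower_entropy (Gi i) v (mui i) y =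
                upper_entropy (Gi i) v (mui i) y) ->
    (forall x, lower_entropy G v mu x = upper_entropy G v mu x) /\
    (v n @[n --> \oo] --> +oo -> weak_LDP G v mu)) /\
  ((forall i (K : set (Xi i)), compact K -> Gi i K) ->
    (forall i, weak_LDP (Gi i) v (mui i)) ->
    weak_LDP G v mu) /\
  ((forall i y, entropy (Gi i) v (mui i) y =
                (- pressure_conj (Gi i) v (mui i) y)%E) ->
    forall x, entropy G v mu x = (- pressure_conj G v mu x)%E).
Proof.
split; last split.
- move=> lu; have lu' := lower_eq_upper_limit Hsys Hlim Hv lu.
  by split => // voo; exact: weak_LDP_entropy_eq.
- exact: (weak_LDP_limit Hsys Hlim Hv).
- move=> sp x; apply/eqP; rewrite eq_le entropy_le_conj//=.
  exact: (conj_le_entropy Hsys Hlim Hv sp).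
Qed.
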